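(* For a loopless matroid $M$ of $n$ elements and rank $r$, $$\mathrm{xc}(B(M)) = O(h(M)\cdot n\cdot r),$$ where $B(M)$ is the base polytope of $M$, $\mathrm{xc}$ denotes extension complexity, and $h(M)$ is the size of the smallest hitting family for $M$.
   Context: Let $M$ be a loopless matroid on a finite ground set $E$, with set of bases $\mathcal{B}$ and rank function $\mathrm{rk}$. For $B\subseteq E$, $\chi^B\in\{0,1\}^E\subset\mathbb{R}^E$ is its incidence vector, and for $x\in\mathbb{R}^E$, $F\subseteq E$, write $x(F)=\sum_{e\in F}x_e$. Base polytope: $B(M)=\mathrm{conv}\{\chi^B : B\in\mathcal{B}\}$. It has the description $B(M)=\{x\in\mathbb{R}^E_{+} : x(E)=\mathrm{rk}(E),\ x(F)\leq \mathrm{rk}(F)\ \text{for every flat } F\subseteq E\}$. Flats and flacets: a set $F\subseteq E$ is a flat if $\mathrm{rk}(F\cup\{e\})>\mathrm{rk}(F)$ for every $e\in E\setminus F$. A flacet of $M$ is a flat $F$ that induces a facet of $B(M)$, i.e. such that $\{x\in B(M): x(F)=\mathrm{rk}(F)\}$ is a facet of $B(M)$. Hitting family: a basis $B$ has full intersection with a flat $F$ if $|B\cap F|=\mathrm{rk}(F)$. A family $\mathcal{V}$ of bases of $M$ is a hitting family for $M$ if, for any flacet $F$ of $M$, there is at least one basis $B\in \mathcal{V}$ that has full intersection with $F$. The number $h(M)$ is the size of the smallest hitting family for $M$. (Facets of $B(M)$ induced by nonnegativity inequalities are ignored in this definition.) Extension complexity: an extended formulation of a polytope $P\subset\mathbb{R}^d$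 is a polyhedron $Q\subset\mathbb{R}^{d+d'}$ that linearly projects to $P$. Its size is its number of inequalities, i.e. the number of facets of $Q$. The extension complexity $\mathrm{xc}(P)$ is the minimum size of an extended formulation of $P$.
   Formalization: The bound is proved with max(1, h(M)) in place of h(M), because the literal bound fails when M has no flacets: for the uniform matroid of rank 1 on n ≥ 2 elements h(M) = 0, while B(M) is a simplex with extension complexity n. *)

(* Defs.v *)
From HB Require Import structures.
From mathcomp Require Import all_boot all_order all_algebra.
From mathcomp Require Import boolp classical_sets reals.

Set Implicit Arguments.
Unset Strict Implicit.
Unset Printing Implicit Defensive.

Import Order.TTheory GRing.Theory Num.Theory.

Section Matroids.
Variable E : finType.

Record matroid := Matroid {
  bases : {set {set E}};
  bases_neq0 : bases != finset.set0;
  basis_exchange : forall B1 B2 : {set E}, B1 \in bases -> B2 \in bases ->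
    forall e : E, e \in B1 :\: B2 ->
    exists2 f : E, f \in B2 :\: B1 & f |: (B1 :\ e) \in bases }.

Variable M : matroid.

Definition rk (F : {set E}) : nat := \max_(B in bases M) #|B :&: F|.

Definition loopless : Prop := forall e : E, 0 < rk [set e]%SET.

Definition flat (F : {set E}) : Prop :=
  forall e : E, e \notin F -> rk F < rk (e |: F).

Definition full_intersection (B F : {set E}) : Prop := #|B :&: F| = rk F.

Lemma full_intersection_exists (F : {set E}) :
  exists2 B, B \in bases M & full_intersection B F.
Proof.
have [|B BM rkF] := @eq_bigmax_cond _ (mem (bases M)) (fun B => #|B :&: F|).
  by rewrite card_gt0 bases_neq0.
by exists B.
Qed.

End Matroids.

Local Open Scope classical_set_scope.
Local Open Scope ring_scope.

Section Polyhedra.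
Variable R : realType.

(* R^o is R seen as a vector space over itself. *)
Definition is_face (V : vectType R) (P F : set V) : Prop :=
  exists (c : 'Hom(V, R^o)) (delta : R),
    (forall x, P x -> c x <= delta) /\ F = [set x | P x /\ c x = delta].

(* U is the direction of the affine hull of S (when S is nonempty). *)
Definition is_direction (V : vectType R) (S : set V) (U : {vspace V}) : Prop :=
  (forall x y, S x -> S y -> x - y \in U) /\
  (forall W : {vspace V},
     (forall x y, S x -> S y -> x - y \in W) -> (U <= W)%VS).

Definition has_dim (V : vectType R) (S : set V) (d : nat) : Prop :=
  S !=set0 /\ exists2 U : {vspace V}, is_direction S U & \dim U = d.

Definition is_facet (V : vectType R) (P F : set V) : Prop :=
  is_face P F /\ exists d : nat, has_dim P d.+1 /\ has_dim F d.

Definition conv (V : vectType R) (I : finType) (p : I -> V) : set V :=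
  [set x | exists lambda : I -> R,
     [/\ forall i, 0 <= lambda i, \sum_i lambda i = 1 &
         x = \sum_i lambda i *: p i]].

Record polytope (V : vectType R) := Polytope {
  points :> set V;
  pointsP : exists (k : nat) (p : 'I_k -> V), points = conv p }.

(* Solutions w of the k inequalities A w <= b and the m equations C w = d. *)
Definition polyhedron (W : vectType R) (k m : nat)
    (A : 'Hom(W, 'cV[R]_k)) (b : 'cV[R]_k)
    (C : 'Hom(W, 'cV[R]_m)) (d : 'cV[R]_m) : set W :=
  [set w | (forall i, A w i ord0 <= b i ord0) /\ C w = d].

(* Equations are not counted in the size: a polyhedron with n facets is defined
   by n inequalities and some equations, and by no fewer inequalities. *)
Definition has_extended_formulation (V : vectType R) (P : set V) (k : nat) :
    Prop :=
  exists (d' m : nat)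
    (A : 'Hom((V * 'cV[R]_d')%type, 'cV[R]_k)) (b : 'cV[R]_k)
    (C : 'Hom((V * 'cV[R]_d')%type, 'cV[R]_m)) (d : 'cV[R]_m)
    (proj : 'Hom((V * 'cV[R]_d')%type, V)),
  proj @` polyhedron A b C d = P.

Lemma has_extended_formulation_ex (V : vectType R) (P : polytope V) :
  exists k, `[< has_extended_formulation P k >].
Proof.
have [k [p ->]] := pointsP P.
pose W := (V * 'cV[R]_k)%type.
pose a (w : W) : 'cV[R]_k := - w.2.
pose c (w : W) : 'cV[R]_1 := const_mx (\sum_i w.2 i ord0).
pose q (w : W) : V := \sum_i w.2 i ord0 *: p i.
have aL : linear a by move=> t u v; rewrite /a /= opprD scalerN.
have cL : linear c.
  move=> t u v; apply/matrixP => i j; rewrite !mxE mulr_sumr -big_split /=.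
  by apply: eq_bigr => l _; rewrite !mxE.
have qL : linear q.
  move=> t u v; rewrite /q scaler_sumr -big_split /=.
  by apply: eq_bigr => l _; rewrite !mxE scalerDl scalerA.
pose aA := GRing.isLinear.Build R W 'cV[R]_k _ a aL.
pose cA := GRing.isLinear.Build R W 'cV[R]_1 _ c cL.
pose qA := GRing.isLinear.Build R W V _ q qL.
pose a' : {linear W -> 'cV[R]_k} := HB.pack a aA.
pose c' : {linear W -> 'cV[R]_1} := HB.pack c cA.
pose q' : {linear W -> V} := HB.pack q qA.
exists k; apply/asboolP.
exists k, 1%N, (linfun a'), 0, (linfun c'), (const_mx 1), (linfun q').
apply/seteqP; split => [_ [w [wge0 w1] <-]|x [l [l0 l1 ->]]].
  exists (fun i => w.2 i ord0); split; last by rewrite lfunE.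
    by move=> i; have := wge0 i; rewrite lfunE /= !mxE oppr_le0.
  by move: w1; rewrite lfunE /= => /matrixP/(_ ord0 ord0); rewrite !mxE.
exists (0, \col_i l i); last first.
  by rewrite lfunE /= /q; apply: eq_bigr => i _; rewrite mxE.
split => [i|]; first by rewrite lfunE /= !mxE oppr_le0.
rewrite lfunE /=; apply/matrixP => i j; rewrite !mxE -[RHS]l1.
by apply: eq_bigr => u _; rewrite mxE.
Qed.

Definition xc (V : vectType R) (P : polytope V) : nat :=
  ex_minn (has_extended_formulation_ex P).

End Polyhedra.

Section BasePolytope.
Variables (R : realType) (E : finType).

Local Notation "'R^E'" := ({ffun E -> R^o} : vectType R).

Definition incidence (B : {set E}) : R^E := [ffun e => (e \in B)%:R].

Variable M : matroid E.

Definition base_set : set R^E :=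
  conv (fun B : {B : {set E} | B \in bases M} => incidence (val B)).

Lemma base_setP : exists (k : nat) (p : 'I_k -> R^E), base_set = conv p.
Proof.
pose I := {B : {set E} | B \in bases M}.
exists #|{: I}|, (fun i => incidence (val (enum_val i : I))).
apply/seteqP; split => x [l [l0 l1 ->]].
  exists (fun i => l (enum_val i)); split => //.
    by rewrite -l1 [RHS](reindex_onto enum_val enum_rank) /=;
      [apply: eq_bigl => i; rewrite enum_valK eqxx | move=> i _; exact: enum_rankK].
  rewrite (reindex_onto enum_val enum_rank) /=; last first.
    by move=> i _; exact: enum_rankK.
  by apply: eq_bigl => i; rewrite enum_valK eqxx.
exists (fun i => l (enum_rank i)); split => //.
  rewrite -l1 (reindex_onto enum_val enum_rank) /=; last first.
    by move=> i _; exact: enum_rankK.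
  by apply: eq_big => i; rewrite enum_valK ?eqxx.
rewrite [RHS](reindex_onto enum_val enum_rank) /=; last first.
  by move=> i _; exact: enum_rankK.
by apply: eq_big => i; rewrite enum_valK ?eqxx.
Qed.

Definition base_polytope : polytope R^E := Polytope base_setP.

Definition flacet (F : {set E}) : Prop :=
  flat M F /\
  is_facet base_polytope
    [set x : R^E | points base_polytope x /\ \sum_(e in F) x e = (rk M F)%:R].

Definition hitting_family (V : {set {set E}}) : Prop :=
  V \subset bases M /\
  forall F : {set E}, flacet F ->
    exists2 B, B \in V & full_intersection M B F.

Lemma hitting_family_ex :
  exists k : nat, `[< exists2 V, hitting_family V & #|V| = k >].
Proof.
exists #|bases M|; apply/asboolP; exists (bases M) => //; split=> // F _.
exact: full_intersection_exists.
Qed.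

(* This is 0 exactly when M has no flacet, e.g. for uniform matroids of
   rank 1: all facets of the standard simplex come from nonnegativity.
   A bound by a multiple of it must therefore use max(1, hitting_number). *)
Definition hitting_number : nat := ex_minn hitting_family_ex.

End BasePolytope.

(* Main.v *)
Require Import Defs.
From HB Require Import structures.
From mathcomp Require Import all_boot all_order all_algebra.
From mathcomp Require Import boolp classical_sets reals.
From mathcomp Require Import zify ring lra fintype finset.

(* For a basis V of a hitting family, write a point x of the base polytope as
   the result of a transport from the incidence vector of V: y v f is the mass
   that v in V sends to f, each v sends total mass 1, f receives x f, and mass
   may flow from v to f only if V - v + f is a basis. For x = incidence of a
   basis such a y is a perfect matching in the exchange graph, obtained by
   iterating symmetric exchange; the general case follows by convexity.
   Conversely, if V has full intersection with F, then no mass enters F from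
   outside, so a transport from V forces x(F) <= rk F. One nonnegative variable
   per triple (V, v, f) thus gives a formulation of size at most h * r * n,
   provided that the flacet inequalities, nonnegativity and the equations
   x(G) = rk G valid on all bases cut out the base polytope. That is Edmonds'
   theorem (uncrossing of tight sets) followed by the fact that a minimal
   subsystem consists of facets. *)

Set Implicit Arguments.
Unset Strict Implicit.
Unset Printing Implicit Defensive.

Import Order.TTheory GRing.Theory Num.Theory.

(** * Bases and rank *)

Section MatroidTheory.
Variables (E : finType) (M : matroid E).
Implicit Types (B V X Y F : {set E}) (e f : E).

Local Notation r := (rk M [set: E]%SET).

Lemma cardsU1D1 V e f : e \in V -> f \notin V -> #|f |: (V :\ e)| = #|V|.
Proof.
move=> eV fV; rewrite cardsU1 !inE (negbTE fV) andbF /= (cardsD1 e V) eV.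
by [].
Qed.

(** Both sides are kept as sums, so that no truncated subtraction arises and [lia] can use the
    identity directly. *)
Lemma card_exchangeI V e f X : e \in V -> f \notin V ->
  (#|(f |: (V :\ e)) :&: X| + (e \in X) = #|V :&: X| + (f \in X))%N.
Proof.
move=> eV fV; have ef : e != f by apply: contraNneq fV => <-.
rewrite (cardsD1 f (_ :&: X)) (cardsD1 e (V :&: X)) !inE eqxx eV /=.
have -> : ((f |: V :\ e) :&: X) :\ f = (V :&: X) :\ e.
  apply/setP => g; rewrite !inE; case: (eqVneq g f) => [->|_] /=; last by rewrite andbA.
  by rewrite (negbTE fV) andbF.
lia.
Qed.

Lemma card_exchangeD V B e f : e \in V -> e \notin B -> f \in B -> f \notin V ->
  #|V :\: B| = #|(f |: (V :\ e)) :\: B|.+1.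
Proof.
move=> eV eB fB fV; rewrite (cardsD1 e) !inE eV eB /= add1n; congr _.+1.
apply: eq_card => g; rewrite !inE; case: (eqVneq g f) => [->|] /=.
  by rewrite fB andbF.
by case: (g \in B); rewrite ?andbF.
Qed.

(** Exchanging [B1] towards [B2] keeps its size and shrinks [B1 :\: B2]. Once this difference is
    empty, so is [B2 :\: B1], since an exchange from [B2] would need a partner in [B1 :\: B2]. *)
Lemma card_bases_eq B1 B2 :
  B1 \in bases M -> B2 \in bases M -> #|B1| = #|B2|.
Proof.
elim: {B1}_.+1 {-2}B1 (ltnSn #|B1 :\: B2|) => // n IHn B1 ltn B1M B2M.
have [D0|[e eD]] := set_0Vmem (B1 :\: B2); last first.
  have [f fD fB] := basis_exchange B1M B2M eD.
  move: eD fD; rewrite !inE => /andP[eB2 eB1] /andP[fB1 fB2].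
  rewrite -(cardsU1D1 eB1 fB1); apply: IHn => //.
  by rewrite (card_exchangeD eB1 eB2 fB2 fB1) in ltn.
have [D0'|[e eD]] := set_0Vmem (B2 :\: B1).
  by apply/eqP; rewrite eqn_leq !subset_leq_card // -setD_eq0 ?D0 ?D0'.
by have [f] := basis_exchange B2M B1M eD; rewrite D0 inE.
Qed.

Lemma leq_rk B F : B \in bases M -> (#|B :&: F| <= rk M F)%N.
Proof.
move=> BM.
exact: (@leq_bigmax_cond _ (mem (bases M)) (fun B => #|B :&: F|)).
Qed.

Lemma card_basis B : B \in bases M -> #|B| = r.
Proof.
move=> BM; have [B' B'M rB'] := full_intersection_exists M [set: E]%SET.
by rewrite -rB' setIT; exact: card_bases_eq.
Qed.

Lemma rk_sub X Y : X \subset Y -> (rk M X <= rk M Y)%N.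
Proof.
move=> XY; have [B BM <-] := full_intersection_exists M X.
by apply: leq_trans (leq_rk Y BM); rewrite subset_leq_card// setIS.
Qed.

Lemma rk_le_card X : (rk M X <= #|X|)%N.
Proof.
by have [B BM <-] := full_intersection_exists M X; rewrite subset_leq_card ?subsetIr.
Qed.

(** Start from a basis optimal for [X] and exchange elements outside [Y] towards a basis [B0]
    optimal for [Y]. The removed elements lie outside [X], so optimality for [X] is never lost,
    while [B :\: B0] shrinks. *)
Lemma full_intersection_chain X Y : X \subset Y ->
  exists B, [/\ B \in bases M, full_intersection M B X & full_intersection M B Y].
Proof.
move=> XY; have [B0 B0M rB0] := full_intersection_exists M Y.
have [B BM rB] := full_intersection_exists M X.
elim: {B}_.+1 {-2}B (ltnSn #|B :\: B0|) BM rB => // n IHn B ltn BM rB.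
have := leq_rk Y BM; rewrite leq_eqVlt => /predU1P[?|]; first by exists B.
rewrite -rB0 => ltY.
(* [B] and [B0] have equal size and [B] has fewer elements in [Y], hence more outside [Y]. *)
have [e] : exists e, e \in (B :\: Y) :\: B0.
  apply/set0Pn; rewrite setD_eq0; apply: contraTN ltY => sub.
  have : (#|B :\: Y| <= #|B0 :\: Y|)%N.
    apply: subset_leq_card; rewrite subsetD sub /=.
    by rewrite disjoint_sym disjoints_subset setCD subsetUr.
  by have := cardsID Y B; have := cardsID Y B0; rewrite (card_bases_eq B0M BM); lia.
rewrite !inE => /and3P[eB0 eY eB].
have [|f] := @basis_exchange _ M B B0 BM B0M e; first by rewrite inE eB eB0.
rewrite inE => /andP[fB fB0] B'M.
apply: (IHn (f |: (B :\ e))) => //.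
  by rewrite (card_exchangeD eB eB0 fB0 fB) in ltn.
apply/eqP; rewrite eqn_leq leq_rk //= -rB.
have := card_exchangeI X eB fB; rewrite (negbTE (contra (subsetP XY e) eY)); lia.
Qed.

(** One basis is optimal for both the intersection and the union, and counting its elements is
    modular. *)
Lemma rk_submod X Y : (rk M (X :|: Y) + rk M (X :&: Y) <= rk M X + rk M Y)%N.
Proof.
have [|B [BM <- <-]] := @full_intersection_chain (X :&: Y) (X :|: Y).
  by rewrite subIset // subsetUl.
apply: leq_trans (leq_add (leq_rk X BM) (leq_rk Y BM)).
by rewrite -(cardsUI (B :&: X)) -setIUr -setIIr.
Qed.

(** A largest superset of [F] of the same rank cannot be enlarged without raising the rank. *)
Lemma flat_closure F :
  exists G, [/\ flat M G, F \subset G & rk M G = rk M F].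
Proof.
have [|G] := @arg_maxnP _ F
    (fun G => (F \subset G) && (rk M G == rk M F)) (fun G => #|G|).
  by rewrite subxx eqxx.
move=> /andP[FG /eqP rG] maxG; exists G; split=> // e eG.
rewrite ltn_neqAle rk_sub ?subsetUr // andbT; apply: contraNneq eG => re.
have := maxG (e |: G); rewrite -re rG eqxx (subset_trans FG (subsetUr _ _)) cardsU1.
by case: (e \in G) => //= /(_ isT); rewrite add1n /= ltnn.
Qed.

Lemma subset_basis X : rk M X = #|X| -> exists2 B, B \in bases M & X \subset B.
Proof.
move=> rX; have [B BM rB] := full_intersection_exists M X; exists B => //.
by apply/setIidPr/eqP; rewrite eqEcard subsetIr rB rX /=.
Qed.

Lemma rk_subbasis B X : B \in bases M -> X \subset B -> rk M X = #|X|.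
Proof.
move=> BM /setIidPr XB; apply/eqP; rewrite eqn_leq rk_le_card /=.
by rewrite -{1}XB leq_rk.
Qed.

Lemma basisE B : (B \in bases M) = (#|B| == r) && (rk M B == r).
Proof.
apply/idP/andP => [BM|[/eqP cB /eqP rB]].
  by rewrite -(card_basis BM) (rk_subbasis BM).
have [|B' B'M BB'] := @subset_basis B; first by rewrite rB cB.
suff -> : B = B' by [].
by apply/eqP; rewrite eqEcard BB' (card_basis B'M) cB /=.
Qed.

(** Let [S] collect the elements of [V] that [f] can replace. If no element of [S :\: B] could
    replace [f] in [B], then [S] would lie in the span of [B :\ f]; as [f] lies in the span of [S],
    so would [f], against the independence of [B]. *)
Lemma symmetric_exchange V B f : V \in bases M -> B \in bases M ->
  f \in B :\: V -> exists e, [/\ e \in V :\: B, f |: (V :\ e) \in bases M &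
    e |: (B :\ f) \in bases M].
Proof.
move=> VM BM; rewrite inE => /andP[fV fB].
pose S := [set e in V | f |: (V :\ e) \in bases M]%SET.
have SV : S \subset V by apply/subsetP => e; rewrite inE => /andP[].
have fS : f \notin S by apply: contra fV; exact: (subsetP SV).
have rS : rk M S = #|S| by exact: rk_subbasis SV.
(* S + f is the fundamental circuit of f with respect to V *)
have rSf : (rk M (f |: S) <= #|S|)%N.
  rewrite leqNgt; apply/negP => ltS.
  (* If [f |: S] were independent, it would extend to a basis [W] inside [f |: V]. Then [W] is [V]
     with some [e] replaced by [f], so [e] is in [S] and hence in [W], a contradiction. *)
  have [|W [WM rW1 rW2]] := @full_intersection_chain (f |: S) (f |: V).
    exact: setUS.
  have fSW : f |: S \subset W.
    by apply/setIidPr/eqP; rewrite eqEcard subsetIr rW1 cardsU1 fS.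
  have WfV : W \subset f |: V.
    apply/setIidPl/eqP; rewrite eqEcard subsetIl rW2 (card_bases_eq WM VM).
    by rewrite -{1}(rk_subbasis VM (subxx V)) rk_sub ?subsetUr.
  have fW : f \in W by apply: (subsetP fSW); rewrite !inE eqxx.
  have [e eVW] : exists e, e \in V :\: W.
    apply/set0Pn; rewrite setD_eq0; apply: contra fV => VW.
    suff -> : V = W by [].
    by apply/eqP; rewrite eqEcard VW (card_bases_eq WM VM) /=.
  move: (eVW); rewrite inE => /andP[eW eV].
  suff eS : e \in S.
    by move: eW; rewrite (subsetP fSW) // inE eS orbT.
  rewrite inE eV /=; suff <- : W = f |: (V :\ e) by [].
  apply/eqP; rewrite eqEcard cardsU1D1 // (card_bases_eq WM VM) leqnn andbT.
  apply/subsetP => g gW; have := subsetP WfV g gW; rewrite !inE.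
  by case: eqVneq => //= _ ->; rewrite andbT; apply: contraNneq eW => <-.
have fT : f \notin B :\ f by rewrite !inE eqxx.
have cT : #|B :\ f| = r.-1 by rewrite -(card_basis BM) (cardsD1 f B) fB.
have r_gt0 : (0 < r)%N by rewrite -(card_basis BM) (cardsD1 f B) fB.
have rT : rk M (B :\ f) = r.-1 by rewrite (rk_subbasis BM) ?subD1set.
case: (pickP [pred e | (e \in S :\: B) && (e |: (B :\ f) \in bases M)]) => [e|no].
  rewrite !inE => /andP[/and3P[eB eV VeM] BeM].
  by exists e; rewrite !inE eV eB.
(* Otherwise some basis consists of [B :\ f] and one further element of [S], which is exactly what
   [no] excludes. *)
exfalso; have rTS : (rk M ((B :\ f) :|: S) <= r.-1)%N.
  rewrite leqNgt; apply/negP => ltr.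
  have [W [WM rW1 rW2]] := full_intersection_chain (subsetUl (B :\ f) S).
  have TW : B :\ f \subset W.
    by apply/setIidPr/eqP; rewrite eqEcard subsetIr rW1 cT rT leqnn.
  have [e] : exists e, e \in (W :&: (B :\ f :|: S)) :\: (B :\ f).
    apply/set0Pn; rewrite setD_eq0; apply: contraTN ltr => /subset_leq_card.
    by rewrite rW2 cT -leqNgt.
  rewrite inE => /andP[eT]; rewrite 2!inE (negbTE eT) /= => /andP[eW eS].
  have ef : e != f by apply: contraNneq fS => <-.
  have eB : e \notin B by move: eT; rewrite !inE ef.
  have /= := no e; rewrite inE eB eS /= => /negP; apply.
  suff -> : e |: (B :\ f) = W by [].
  apply/eqP; rewrite eqEcard subUset sub1set eW TW cardsU1 eT cT (card_basis WM).
  by rewrite /= add1n prednK.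
(* The two sets meet in [S] and their union contains [B], so submodularity yields r + |S| <= |S| +
   (r - 1). *)
have := rk_submod (f |: S) (B :\ f :|: S).
have -> : (f |: S) :&: (B :\ f :|: S) = S.
  apply/setP => g; rewrite in_setI !in_setU in_set1 in_setD1.
  case: (eqVneq g f) => [->|_] /=; last first.
    by case: (g \in S); rewrite ?orbT ?andbF.
  by rewrite (negbTE fS).
rewrite rS; have : (r <= rk M ((f |: S) :|: (B :\ f :|: S)))%N.
  rewrite -(card_basis BM) -(rk_subbasis BM (subxx B)) rk_sub //.
  apply/subsetP => g gB; rewrite !inE gB.
  by case: eqVneq => //= _; rewrite orbT.
lia.
Qed.

End MatroidTheory.

Local Open Scope ring_scope.

(** * Perfect matchings in the exchange graph of a basis *)

Section ExchangeMatrix.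
Variables (R : numDomainType) (E : finType) (M : matroid E).
Implicit Types (B V : {set E}).

(** Induction on [#|B :\: V|]: a symmetric exchange of [f0] for [e] brings [B] closer to [V], and
    the matching for the new basis is corrected in the single row [e]. *)
Lemma exchange_matrix V B : V \in bases M -> B \in bases M ->
  exists y : E -> E -> R,
    [/\ forall v f, 0 <= y v f,
        forall v f, v \in V -> y v f != 0 -> f |: (V :\ v) \in bases M,
        forall v, v \in V -> \sum_f y v f = 1 &
        forall f, \sum_(v in V) y v f = (f \in B)%:R].
Proof.
move=> VM BM.
(* The added last clause, that common elements are matched to themselves, makes the induction work:
   it says what row [e] contains before it is overwritten. *)
suff [y [? ? ? ? _]] : exists y : E -> E -> R,
    [/\ forall v f, 0 <= y v f,
        forall v f, v \in V -> y v f != 0 -> f |: (V :\ v) \in bases M,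
        forall v, v \in V -> \sum_f y v f = 1,
        forall f, \sum_(v in V) y v f = (f \in B)%:R &
        forall v f, v \in V -> v \in B -> y v f = (f == v)%:R] by exists y.
elim: {B}_.+1 {-2}B (ltnSn #|B :\: V|) BM => // n IHn B ltn BM.
have [D0|[f0 fD]] := set_0Vmem (B :\: V).
  have -> : B = V.
    by apply/eqP; rewrite eqEcard -setD_eq0 D0 eqxx (card_bases_eq VM BM) /=.
  exists (fun v f => (f == v)%:R); split=> //.
  - by move=> v f vV; rewrite pnatr_eq0 eqb0 negbK => /eqP->; rewrite setD1K.
  - by move=> v vV; rewrite (bigD1 v) //= eqxx big1 ?addr0 // => f /negbTE->.
  - move=> f; case: (boolP (f \in V)) => fV.
      rewrite (bigD1 f) //= eqxx big1 ?addr0 // => v /andP[_ /negbTE].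
      by rewrite eq_sym => ->.
    rewrite big1 // => v vV; rewrite (_ : _ == _ = false) //.
    by apply: contraNF fV => /eqP->.
have [e [eD VeM BeM]] := symmetric_exchange VM BM fD.
move: (fD) (eD); rewrite !inE => /andP[fV fB] /andP[eB eV].
have [||y [y0 yM y1 yB yid]] := IHn (e |: (B :\ f0)) => //.
  by rewrite (card_exchangeD fB fV eV eB) in ltn.
have ef : f0 != e by apply: contraNneq fV => ->.
(* In the matching for [e |: (B :\ f0)], [e] is matched to itself; it is redirected to [f0], which
   is allowed by [VeM]. *)
exists (fun v f => if v == e then (f == f0)%:R else y v f); split.
- by move=> v f /=; case: ifP.
- move=> v f vV /=; have [->|_] := eqVneq v e; last exact: yM.
  by rewrite pnatr_eq0 eqb0 negbK => /eqP->.
- move=> v vV /=; have [_|_] := eqVneq v e; last exact: y1.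
  by rewrite (bigD1 f0) //= eqxx big1 ?addr0 // => f /negbTE->.
- move=> f; rewrite (bigD1 e) //= eqxx.
  rewrite (eq_bigr (y^~ f)); last by move=> v /andP[_ /negbTE->].
  have := yB f; rewrite (bigD1 e) //= (yid e) ?setU11 // => /(canRL (addKr _)) ->.
  rewrite !inE; case: (eqVneq f e) => [->|fe] /=.
    by rewrite (negbTE eB) eq_sym (negbTE ef) addNr addr0.
  by case: (eqVneq f f0) => [->|] /=; rewrite ?fB ?oppr0 ?addr0 ?add0r.
- move=> v f vV vB; have ve : v != e by apply: contraNneq eB => <-.
  by rewrite (negbTE ve) yid // !inE vB (negbTE ve) /= (contraNneq _ fV) // => <-.
Qed.

End ExchangeMatrix.

(** * Edmonds' description of the base polytope *)

Section Convexity.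
Variables (R : realType) (V : vectType R) (I : finType) (p : I -> V).

Lemma conv_point i : conv p (p i).
Proof.
exists (fun j => (j == i)%:R); split=> //.
  by rewrite (bigD1 i) //= eqxx big1 ?addr0 // => j /negbTE->.
by rewrite (bigD1 i) //= eqxx scale1r big1 ?addr0 // => j /negbTE->; rewrite scale0r.
Qed.

Lemma conv_comb x y (a b : R) : conv p x -> conv p y -> 0 <= a -> 0 <= b ->
  a + b = 1 -> conv p (a *: x + b *: y).
Proof.
move=> [l [l0 l1 ->]] [m [m0 m1 ->]] a0 b0 ab.
exists (fun i => a * l i + b * m i); split.
- by move=> i; rewrite addr_ge0 ?mulr_ge0.
- by rewrite big_split -!mulr_sumr /= l1 m1 !mulr1.
- rewrite !scaler_sumr -big_split; apply: eq_bigr => i _ /=.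
  by rewrite scalerDl !scalerA.
Qed.

End Convexity.

Section Edmonds.
Variables (R : realType) (E : finType) (M : matroid E).
Implicit Types (x : {ffun E -> R^o}) (A B F T : {set E}) (e i j : E).

Local Notation r := (rk M [set: E]%SET).
Local Notation rkR F := ((rk M F)%:R : R).

Definition weight x F : R := \sum_(e in F) x e.

Lemma weightUI x A B :
  weight x (A :|: B) + weight x (A :&: B) = weight x A + weight x B.
Proof.
rewrite /weight !(big_mkcond (fun e => e \in _)) -!big_split /=.
apply: eq_bigr => e _; rewrite !inE.
by case: (e \in A); case: (e \in B); rewrite /= ?addr0 ?add0r.
Qed.

Lemma weightID x A B : weight x A = weight x (A :&: B) + weight x (A :\: B).
Proof. by rewrite /weight (big_setID B). Qed.

Lemma weight_incidence B F : weight (incidence R B) F = #|B :&: F|%:R.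
Proof.
rewrite /weight -sum1_card natr_sum [RHS]big_mkcond [LHS]big_mkcond.
by apply: eq_bigr => e _; rewrite ffunE !inE; case: (e \in F); case: (e \in B).
Qed.

Definition rank_feasible x :=
  weight x [set: E] = rkR [set: E] /\ forall F, weight x F <= rkR F.

Definition tight x F : bool := weight x F == rkR F.

Lemma rank_feasible_ge0 x e : rank_feasible x -> 0 <= x e.
Proof.
move=> [xE xF]; have := weightID x [set: E] [set e].
rewrite setTI xE {1}/weight big_set1 => /(canLR (addrK _)) <-.
rewrite subr_ge0 (le_trans (xF _)) // ler_nat rk_sub //; exact: finset.subsetT.
Qed.

Lemma rank_feasible_le1 x e : rank_feasible x -> x e <= 1.
Proof.
move=> [_ xF]; have := xF [set e]; rewrite /weight big_set1 => h; apply: (le_trans h).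
by rewrite -[1]/(1%:R) ler_nat (leq_trans (rk_le_card _ _)) ?cards1.
Qed.

(** Uncrossing: [weight] is modular and the rank submodular, so no slack is left at the union or the
    intersection. *)
Lemma tightI x A B : rank_feasible x -> tight x A -> tight x B -> tight x (A :&: B).
Proof.
move=> [_ xF] /eqP tA /eqP tB; rewrite /tight eq_le xF /=.
have := weightUI x A B; rewrite tA tB.
have := xF (A :|: B); have : rkR (A :|: B) + rkR (A :&: B) <= rkR A + rkR B.
  by rewrite -!natrD ler_nat rk_submod.
lra.
Qed.

(** For feasible [x] this is the least tight set containing [i], because tight sets are closed under
    intersection and the ground set is tight. *)
Definition hull x i := \bigcap_(F | tight x F && (i \in F)) F.

Lemma tight_hull x i : rank_feasible x -> tight x (hull x i).
Proof.
move=> Px; rewrite /hull; elim/big_ind: _ => [|A B|F /andP[]//].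
  by apply/eqP; have [] := Px.
exact: tightI.
Qed.

Lemma mem_hull x i : i \in hull x i.
Proof. by apply/bigcapP => F /andP[]. Qed.

Lemma hull_sub x i F : tight x F -> i \in F -> hull x i \subset F.
Proof. by move=> tF iF; apply: (bigcap_inf F); rewrite tF iF. Qed.

(** Mass moves from [j] to [i] until a set containing [i] but not [j] becomes tight. Tight sets do
    not separate [i] from [j], so they all stay tight. *)
Lemma feasible_move x i j : rank_feasible x -> i != j ->
  (forall F, tight x F -> (i \in F) = (j \in F)) ->
  exists2 t : R, 0 < t &
    let z := [ffun e => x e + t * ((e == i)%:R - (e == j)%:R)] : {ffun E -> R^o} in
    rank_feasible z /\
    (#|[set F | ~~ tight z F]| < #|[set F | ~~ tight x F]|)%N.
Proof.
move=> [xE xF] ij tij.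
(* [F0] has the least slack among the sets whose weight increases; this slack is the step length
   [t]. *)
have [|F0 /andP[iF0 jF0] minF0] := @arg_minP _ R _ [set i]
    (fun F => (i \in F) && (j \notin F)) (fun F => rkR F - weight x F).
  by rewrite !inE eqxx eq_sym ij.
have ntF0 : ~~ tight x F0.
  by apply: contra jF0 => /tij <-.
set t := rkR F0 - weight x F0.
have t0 : 0 < t by rewrite subr_gt0 lt_neqAle xF andbT.
exists t => // z.
have wz F : weight z F = weight x F + t * ((i \in F)%:R - (j \in F)%:R).
  have delta k : \sum_(e in F) (e == k)%:R = (k \in F)%:R :> R.
    case: (boolP (k \in F)) => kF.
      by rewrite (bigD1 k) //= eqxx big1 ?addr0 // => e /andP[_ /negbTE->].
    by rewrite big1 // => e eF; case: eqP => // ek; rewrite -ek eF in kF.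
  rewrite /weight -(delta i) -(delta j) -sumrB mulr_sumr -big_split.
  by apply: eq_bigr => e _; rewrite ffunE.
have zF F : weight z F <= rkR F.
  rewrite wz; have := xF F.
  case: (boolP (i \in F)) => iF; case: (boolP (j \in F)) => jF /=; try by move: t0; lra.
  by have := minF0 F; rewrite iF jF => /(_ isT); rewrite -/t; lra.
split; first by split=> //; rewrite wz !inE subrr mulr0 addr0.
apply/proper_card/properP; split.
  apply/subsetP => F; rewrite !inE; apply: contra => tF.
  by rewrite /tight wz tij // subrr mulr0 addr0.
exists F0; rewrite !inE //= negbK /tight wz iF0 (negbTE jF0) /t; apply/eqP.
by rewrite subr0 mulr1 addrC subrK.
Qed.

(** The coordinates lie between 0 and 1, so [x] is the incidence vector of a set of size r, and
    feasibility at this set makes it independent. *)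
Lemma rank_feasible_int x : rank_feasible x ->
  (forall e, x e \is a Num.int) -> base_set M x.
Proof.
move=> Px xint; pose B := [set e | x e == 1].
have xB : x = incidence R B.
  apply/ffunP => e; rewrite ffunE inE.
  have := rank_feasible_ge0 e Px; have := rank_feasible_le1 e Px.
  have /intrP[m ->] := xint e; rewrite ler0z lerz1 => m1 m0.
  have /orP[/eqP->|/eqP->] : (m == 0) || (m == 1) by lia.
    by rewrite eq_sym oner_eq0.
  by rewrite eqxx.
case: Px => xE xF; have BM : B \in bases M.
  move: xE (xF B); rewrite xB !weight_incidence setIT setIid.
  move=> /eqP; rewrite eqr_nat ler_nat => /eqP cB le.
  by rewrite basisE cB eqxx eqn_leq -{1 2}cB rk_le_card.
by rewrite xB; apply: (conv_point _ (exist _ B BM : {B | B \in bases M})).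
Qed.

(** Induction on the number of non-tight sets: a fractional [x] lies on a segment between two
    feasible points with more tight sets. *)
Lemma rank_feasible_base x : rank_feasible x -> base_set M x.
Proof.
elim: {x}_.+1 {-2}x (ltnSn #|[set F | ~~ tight x F]|) => // n IHn x ltn Px.
have [/forallP xint|] := boolP [forall e, x e \is a Num.int].
  exact: rank_feasible_int.
rewrite negb_forall => /existsP[i0 i0P].
have [//|i iP mini] := @arg_minnP _ i0
    (fun e => x e \isn't a Num.int) (fun e => #|hull x e|).
(* The hull of [i] is tight, so its weight is an integer and [i] cannot be its only fractional
   element. By minimality of the hull, [j] then has the same hull and no tight set separates the
   two. *)
have [j] : exists j, [&& j \in hull x i, j != i & x j \isn't a Num.int].
  apply/existsP; apply: contraR iP; rewrite negb_exists => /forallP nj.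
  have := tight_hull i Px; rewrite /tight /weight (bigD1 i) ?mem_hull //= => /eqP.
  move=> /(canRL (addrK _)) ->; rewrite rpredB ?natr_int //.
  apply: rpred_sum => e /andP[eH ei]; have := nj e.
  by rewrite eH ei negbK.
move=> /and3P[jH ji jint].
have Hji : hull x j = hull x i.
  by apply/eqP; rewrite eqEcard mini // hull_sub ?tight_hull.
have tij F : tight x F -> (i \in F) = (j \in F).
  move=> tF; apply/idP/idP => kF.
    exact: (subsetP (hull_sub tF kF)).
  by apply: (subsetP (hull_sub tF kF)); rewrite Hji mem_hull.
have ij : i != j by rewrite eq_sym.
have [t t0 [Py lty]] := feasible_move Px ij tij.
have [|s s0 [Pz ltz]] := @feasible_move x j i Px ji.
  by move=> F /tij.
have {}Py := IHn _ (leq_trans lty ltn) Py.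
have {}Pz := IHn _ (leq_trans ltz ltn) Pz.
have ts : t + s != 0 by rewrite gt_eqF ?addr_gt0.
(* The two moves go a distance [t] one way and [s] the opposite way; with these weights the
   displacements cancel. *)
have := @conv_comb _ _ _ _ _ _ (s / (t + s)) (t / (t + s)) Py Pz.
rewrite !divr_ge0 ?addr_ge0 ?ltW // -mulrDl [s + t]addrC divff // => /(_ isT isT erefl).
set w := (X in conv _ X); suff -> : w = x by [].
apply/ffunP => e; rewrite !ffunE /GRing.scale /=.
by field.
Qed.

End Edmonds.

(** * Facets and extended formulations *)

Lemma hom_of_linear (R : realType) (aT rT : vectType R) (f : aT -> rT) :
  linear f -> exists g : 'Hom(aT, rT), g =1 f.
Proof.
move=> fL; pose fA := GRing.isLinear.Build R aT rT _ f fL.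
pose f' : {linear aT -> rT} := HB.pack f fA.
by exists (linfun f') => x; rewrite lfunE.
Qed.

Section Facets.
Variables (R : realType) (V : vectType R).
Implicit Types (S P : classical_sets.set V) (U : {vspace V}).

Lemma small_step (I : finType) (A : {set I}) (a c : I -> R) :
  (forall i, i \in A -> 0 < a i) ->
  exists2 eps : R, 0 < eps & forall i, i \in A -> eps * c i <= a i.
Proof.
(* The step is the inverse of [1 + s]; the 1 keeps it defined when [s] is zero. *)
move=> a0; pose s := \sum_(i in A) `|c i| / a i.
have s0 : 0 <= s by apply: sumr_ge0 => i /a0 ai; rewrite divr_ge0 // ltW.
have s1 : 0 < 1 + s by rewrite ltr_wpDr.
exists (1 + s)^-1 => [|i iA]; first by rewrite invr_gt0.
rewrite mulrC ler_pdivrMr // (le_trans (ler_norm _)) //.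
rewrite mulrC -ler_pdivrMr ?a0 // (le_trans (_ : _ <= s)) ?lerDr //.
rewrite /s (bigD1 i) //= lerDl; apply: sumr_ge0 => k /andP[/a0 ak _].
by rewrite divr_ge0 // ltW.
Qed.

(** Directions of polytopes and faces are computed from one relatively interior point; the step
    length may depend on the direction. *)
Lemma is_direction_of_point S p U : S p ->
  (forall x, S x -> x - p \in U) ->
  (forall u, u \in U -> exists2 eps : R, 0 < eps & S (p + eps *: u)) ->
  is_direction S U.
Proof.
move=> Sp SU US; split=> [x y Sx Sy|W SW].
  have -> : x - y = (x - p) - (y - p) by rewrite opprB addrA subrK.
  by rewrite rpredB ?SU.
apply/subvP => u /US[eps eps0 Sq].
have := SW _ _ Sq Sp; rewrite addrC addKr => /(memvZ eps^-1).
by rewrite scalerA mulVf ?scale1r // gt_eqF.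
Qed.

Variables (I : finType) (f : I -> 'Hom(V, R^o)) (b : I -> R).
Variables (U : {vspace V}) (z : V) (A : {set I}) (P : classical_sets.set V).
Hypothesis PE : forall x,
  P x <-> x - z \in U /\ forall i, i \in A -> f i x <= b i.
Hypothesis z_interior : forall i, i \in A -> f i z < b i.

(** The segment from the interior point [z] to [y] meets the hyperplane of [j] at a point [p] where
    all other inequalities are strict. So the face has direction [U :&: lker (f j)], one dimension
    below [U]. *)
Lemma irredundant_facet j y : j \in A -> y - z \in U ->
  (forall i, i \in A :\ j -> f i y <= b i) -> b j < f j y ->
  is_facet P (fun x => P x /\ f j x = b j).
Proof.
move=> jA yU yA yj.
have zj := z_interior jA.
pose t := (b j - f j z) / (f j y - f j z).
have t0 : 0 < t by rewrite divr_gt0 // subr_gt0 // (lt_trans zj).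
have t1 : t < 1 by rewrite ltr_pdivrMr ?subr_gt0 ?(lt_trans zj) // mul1r ltrD2r.
pose p := z + t *: (y - z).
have fp i : f i p = (1 - t) * f i z + t * f i y.
  have affine (u v : R) : u + t * (v - u) = (1 - t) * u + t * v by ring.
  by rewrite /p linearD linearZ linearB; exact: affine.
have pj : f j p = b j.
  rewrite fp /t; have : f j y - f j z != 0 by rewrite subr_eq0 gt_eqF // (lt_trans zj).
  by move=> ?; field.
have pA i : i \in A :\ j -> f i p < b i.
  move=> iA; have := yA i iA; move: iA; rewrite !inE => /andP[_ /z_interior zi] yi.
  rewrite fp; have : (1 - t) * f i z < (1 - t) * b i by rewrite ltr_pM2l ?subr_gt0.
  have : t * f i y <= t * b i by rewrite ler_pM2l.
  by move=> h1 h2; have := ltr_leD h2 h1; rewrite -mulrDl subrK mul1r.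
have pU : p - z \in U by rewrite /p addrC addKr memvZ.
have Pp : P p.
  apply/PE; split=> // i iA; have [->|ij] := eqVneq i j; first by rewrite pj.
  by rewrite ltW // pA // !inE ij.
have Pz : P z.
  by apply/PE; rewrite subrr mem0v; split=> // i /z_interior /ltW.
split.
  exists (f j), (b j); split=> // x /PE[_ xA]; exact: xA.
exists (\dim (U :&: lker (f j))); split.
- split; first by exists z.
  exists U.
    apply: (is_direction_of_point Pz) => [x /PE[]//|u uU].
    have [|eps eps0 le] := @small_step _ A (fun i => b i - f i z) (fun i => f i u).
      by move=> i /z_interior; rewrite subr_gt0.
    exists eps => //; apply/PE; split; first by rewrite addrC addKr memvZ.
    by move=> i iA; rewrite linearD linearZ -lerBrDl; exact: le.
  (* Rank-nullity: [f j] maps [U] onto a line, as it does not vanish at [y - z]. *)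
  rewrite -(limg_ker_dim (f j) U) -addn1; congr addn.
  have le1 : (\dim (f j @: U) <= 1)%N.
    by rewrite (leq_trans (dimvS (subvf _))) // dimvf.
  apply/eqP; rewrite eqn_leq le1 lt0n dimv_eq0; apply/negP => /eqP fU0.
  have := memv_img (f j) yU; rewrite fU0 memv0 linearB subr_eq0 gt_eqF //.
  exact: lt_trans yj.
- split; first by exists p.
  exists (U :&: lker (f j))%VS => //.
  apply: (@is_direction_of_point _ p) => // [x [/PE[xU _] xj]|u].
    rewrite memv_cap memv_ker linearB /= xj pj subrr eqxx andbT.
    have -> : x - p = (x - z) - (p - z) by rewrite opprB addrA subrK.
    by rewrite rpredB.
  rewrite memv_cap memv_ker => /andP[uU /eqP uj].
  have [|eps eps0 le] := @small_step _ (A :\ j) (fun i => b i - f i p) (fun i => f i u).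
    by move=> i /pA; rewrite subr_gt0.
  have ej : f j (p + eps *: u) = b j by rewrite linearD linearZ /= uj scaler0 addr0.
  exists eps => //; split=> //; apply/PE; split.
    by rewrite addrAC rpredD // memvZ.
  move=> i iA; have [->|ij] := eqVneq i j; first by rewrite ej.
  by rewrite linearD linearZ -lerBrDl le // !inE ij.
Qed.

End Facets.

(* In a minimal subsystem that still describes [P], every inequality is
   irredundant. *)
Lemma facet_description (R : realType) (V : vectType R) (I : finType)
    (f : I -> 'Hom(V, R^o)) (b : I -> R) (U : {vspace V}) (z : V)
    (A : {set I}) (P : classical_sets.set V) :
  (forall x, P x <-> x - z \in U /\ forall i, i \in A -> f i x <= b i) ->
  (forall i, i \in A -> f i z < b i) ->
  forall x, x - z \in U ->
    (forall i, i \in A -> is_facet P (fun x => P x /\ f i x = b i) ->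
      f i x <= b i) -> P x.
Proof.
move=> PE zA.
pose desc (D : {set I}) := `[< forall x, x - z \in U ->
  (forall i, i \in D -> f i x <= b i) -> P x >].
have [|D /andP[DA /asboolP Ddesc] minD] := @arg_minnP _ A
    (fun D => (D \subset A) && desc D) (fun D => #|D|).
  by rewrite subxx; apply/asboolP => x xU xA; apply/PE.
have PD x : P x <-> x - z \in U /\ forall i, i \in D -> f i x <= b i.
  split=> [/PE[xU xA]|[]]; last exact: Ddesc.
  by split=> // i /(subsetP DA); exact: xA.
have zD i : i \in D -> f i z < b i by move/(subsetP DA); exact: zA.
move=> x xU xF; apply: (Ddesc) => // j jD; apply: xF; first exact: (subsetP DA).
have : ~~ desc (D :\ j).
  apply/negP => descj; have := minD (D :\ j).
  rewrite descj (subset_trans (subD1set _ _) DA) => /(_ isT).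
  by rewrite (cardsD1 j D) jD add1n ltnn.
(* By minimality of [D], dropping [j] admits a point [y] outside [P]; it can violate only inequality
   [j]. *)
move=> /asboolPn/existsNP[y /not_implyP[yU /not_implyP[yD nPy]]].
apply: (irredundant_facet PD zD jD yU yD).
rewrite ltNge; apply/negP => yj; apply: nPy; apply: Ddesc => // i iD.
by have [->//|ij] := eqVneq i j; apply: yD; rewrite !inE ij.
Qed.

(** Only the sign constraints on the variables indexed by [D] are inequalities, and equations are
    free. *)
Lemma system_extended_formulation (R : realType) (V : vectType R)
    (P : classical_sets.set V) (T J : finType) (D : {set T})
    (a : J -> 'Hom(V, R^o)) (c : J -> T -> R) (d : J -> R) :
  (forall x, P x <-> exists2 y : T -> R, forall t, t \in D -> 0 <= y t &
     forall j, a j x + \sum_(t in D) c j t * y t = d j) ->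
  has_extended_formulation P #|D|.
Proof.
move=> PE; pose W := (V * 'cV[R]_#|D|)%type.
have [A AE] : exists A : 'Hom(W, 'cV[R]_#|D|), A =1 (fun w => - w.2).
  by apply: hom_of_linear => t u v; rewrite opprD scalerN.
have [proj projE] : exists p : 'Hom(W, V), p =1 fst by exact: hom_of_linear.
have [C CE] : exists C : 'Hom(W, 'cV[R]_#|J|), C =1 (fun w =>
    \col_j (a (enum_val j) w.1 +
            \sum_(i < #|D|) c (enum_val j) (enum_val i) * w.2 i ord0)).
  apply: hom_of_linear => t u v; apply/matrixP => i j; rewrite !mxE linearP /=.
  rewrite mulrDr addrACA mulr_sumr -big_split; congr (_ + _).
  by apply: eq_bigr => l _; rewrite !mxE mulrDr mulrCA.
exists #|D|, #|J|, A, 0, C, (\col_j d (enum_val j)), proj.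
apply/seteqP; split=> [_ [w [w0 wC] <-]|x /PE[y y0 yd]].
  have w0' i : 0 <= w.2 i ord0 by have := w0 i; rewrite AE !mxE oppr_le0.
  rewrite projE; apply/PE.
  (* This sum has one term, the coordinate of [t], when [t] is in [D], and is empty otherwise. *)
  exists (fun t => \sum_(i | enum_val i == t) w.2 i ord0) => [t _|j].
    exact: sumr_ge0.
  move: wC; rewrite CE => /matrixP/(_ (enum_rank j) ord0); rewrite !mxE enum_rankK.
  move=> <-; rewrite big_enum_val; congr (_ + _); apply: eq_bigr => i _.
  by rewrite (big_pred1 i) // => k; rewrite (inj_eq enum_val_inj).
exists (x, \col_i y (enum_val i)); last by rewrite projE.
split=> [i|]; first by rewrite AE !mxE oppr_le0 y0 ?enum_valP.
rewrite CE; apply/matrixP => i j; rewrite !mxE -[RHS]yd.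
rewrite [in RHS]big_enum_val; congr (_ + _).
by apply: eq_bigr => t _; rewrite mxE.
Qed.

(** * The base polytope is cut out by its flacets *)

Section BaseDescription.
Variables (R : realType) (E : finType) (M : matroid E).
Implicit Types (x : {ffun E -> R^o}) (B F G V : {set E}).

Local Notation r := (rk M [set: E]).
Local Notation rkR F := ((rk M F)%:R : R).
Local Notation basis := {B : {set E} | B \in bases M}.

(** These sets supply the equations valid on the whole base polytope. *)
Definition always_tight G : bool := [forall B in bases M, #|B :&: G| == rk M G].

Lemma weight_linear F : linear ((fun x => weight x F) : {ffun E -> R^o} -> R^o).
Proof.
move=> t u v; rewrite /weight scaler_sumr -big_split; apply: eq_bigr => e _.
by rewrite !ffunE.
Qed.

Lemma weight_conv (l : basis -> R) F :
  weight (\sum_B l B *: incidence R (val B)) F = \sum_B l B * #|val B :&: F|%:R.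
Proof.
have [w wE] := hom_of_linear (weight_linear F).
rewrite -wE linear_sum; apply: eq_bigr => B _.
by rewrite linearZ /= wE weight_incidence.
Qed.

Lemma base_set_weight x F : base_set M x ->
  [/\ forall e, 0 <= x e, weight x F <= rkR F &
      always_tight F -> weight x F = rkR F].
Proof.
move=> [l [l0 l1 ->]].
have rkE : rkR F = \sum_B l B * rkR F by rewrite -mulr_suml l1 mul1r.
split; rewrite ?weight_conv 1?rkE.
- by move=> e; rewrite sum_ffunE sumr_ge0 // => B _; rewrite !ffunE mulr_ge0.
- by apply: ler_sum => B _; rewrite ler_wpM2l // ler_nat leq_rk ?(valP B).
- by move=> /forall_inP tF; apply: eq_bigr => B _; rewrite (eqP (tF _ (valP B))).
Qed.

(** The average of all bases is strict in an inequality as soon as one basis is. Looplessness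
    provides a basis through each element. *)
Lemma base_set_interior_point : loopless M ->
  exists z : {ffun E -> R^o}, [/\ base_set M z, forall e, 0 < z e &
    forall F, ~~ always_tight F -> weight z F < rkR F].
Proof.
move=> ll; have /set0Pn[B0 B0M] := bases_neq0 M.
pose N : R := #|{: basis}|%:R.
have N0 : 0 < N.
  by rewrite ltr0n; apply/card_gt0P; exists (exist _ B0 B0M).
have sumN : \sum_(B : basis) N^-1 = 1.
  by rewrite sumr_const -mulr_natl mulfV // gt_eqF.
have pos (g : basis -> R) (B : basis) : (forall C, 0 <= g C) -> 0 < g B ->
    0 < \sum_C N^-1 * g C.
  move=> g0 gB; rewrite (bigD1 B) //= ltr_wpDr ?mulr_gt0 ?invr_gt0 //.
  by apply: sumr_ge0 => B' _; rewrite mulr_ge0 // invr_ge0 ltW.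
exists (\sum_(B : basis) N^-1 *: incidence R (val B)); split.
- by exists (fun=> N^-1); split=> // _; rewrite invr_ge0 ltW.
- move=> e; have [B BM rB] := full_intersection_exists M [set e].
  rewrite sum_ffunE; under eq_bigr => B' _ do rewrite !ffunE.
  apply: (pos (fun B' : basis => (e \in val B')%:R) (exist _ B BM)) => //=.
  rewrite ltr0n lt0b; move: (ll e); rewrite -rB card_gt0 => /set0Pn[e'].
  by rewrite !inE => /andP[eB /eqP <-].
- move=> F /forall_inPn[B BM BF]; rewrite weight_conv -subr_gt0.
  have -> : rkR F - \sum_(B : basis) N^-1 * #|val B :&: F|%:R =
      \sum_(B : basis) N^-1 * (rkR F - #|val B :&: F|%:R).
    by rewrite -[X in X - _]mul1r -sumN mulr_suml -sumrB; apply: eq_bigr => *; ring.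
  apply: (pos _ (exist _ B BM)) => [B'|] /=.
    by rewrite subr_ge0 ler_nat leq_rk // (valP B').
  by rewrite subr_gt0 ltr_nat ltn_neqAle BF leq_rk.
Qed.

(** [facet_description] is applied to nonnegativity and the flat inequalities, inside the affine
    space of the valid equations. Nonnegativity is assumed for every element, so only the flats have
    to be sorted into facets and others. *)
Lemma base_set_flacets : loopless M ->
  forall x, (forall e, 0 <= x e) ->
    (forall G, always_tight G -> weight x G = rkR G) ->
    (forall F, flacet R M F -> weight x F <= rkR F) ->
  base_set M x.
Proof.
move=> ll; have [z [zP z_gt0 zF]] := base_set_interior_point ll.
have /choice[w wE] (F : {set E}) : exists w : 'Hom({ffun E -> R^o} : vectType R, R^o),
    forall x, w x = weight x F by exact: hom_of_linear (@weight_linear F).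
pose f (i : E + {set E}) := match i with inl e => - w [set e] | inr F => w F end.
pose b (i : E + {set E}) : R := match i with inl e => 0 | inr F => rkR F end.
(* Always tight flats are left out, since [z] is not strict there; they are covered by [U]. *)
pose A := [set i : E + {set E} |
  if i is inr F then `[< flat M F >] && ~~ always_tight F else true].
pose U := (\bigcap_(G | always_tight G) lker (w G))%VS.
have fE e x : f (inl e) x = - x e.
  by rewrite /f /= opp_lfunE wE /weight big_set1.
have UE x : x - z \in U <-> forall G, always_tight G -> weight x G = rkR G.
  rewrite memvE; split.
    move=> /subv_bigcapP xU G tG; have := xU G tG.
    rewrite -memvE memv_ker linearB subr_eq0 /= !wE => /eqP->.
    by have [_ _ ->] := base_set_weight G zP.
  move=> xG; apply/subv_bigcapP => G tG.
  rewrite -memvE memv_ker linearB subr_eq0 /= !wE xG //.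
  by have [_ _ ->] := base_set_weight G zP.
have PE x : base_set M x <-> x - z \in U /\ forall i, i \in A -> f i x <= b i.
  split=> [xP|[/UE xU xA]].
    split; first by apply/UE => G; have [] := base_set_weight G xP.
    case=> [e|F] _; first by rewrite fE oppr_le0; have [] := base_set_weight set0 xP.
    by rewrite /f wE; have [] := base_set_weight F xP.
  have x0 e : 0 <= x e by have := xA (inl e); rewrite inE fE oppr_le0; apply.
  apply: rank_feasible_base; split.
    apply: xU; apply/forall_inP => B BM; by rewrite setIT (card_basis BM).
  (* As [x] is nonnegative, passing to the closure only increases the weight and keeps the rank. *)
  move=> F; have [G [fG FG <-]] := flat_closure M F.
  apply: (@le_trans _ _ (weight x G)).
    rewrite (weightID x G F) (setIidPr FG) lerDl; exact: sumr_ge0.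
  have [tG|ntG] := boolP (always_tight G); first by rewrite xU.
  by have := xA (inr G); rewrite inE /f wE; apply; rewrite ntG andbT; apply/asboolP.
move=> x x0 xT xF; apply: (facet_description PE) => [[e|F]|| [e|F]].
- by rewrite fE oppr_lt0.
- by rewrite inE /f wE => /andP[_ /zF].
- by apply/UE.
- by rewrite fE oppr_le0.
- rewrite inE => /andP[/asboolP fF _] facF; rewrite /f wE; apply: xF; split=> //.
  congr is_facet: facF; apply/funext => y; apply/propext.
  by rewrite /f wE.
Qed.

End BaseDescription.

(** * Transports from a basis *)

Lemma sum_pair_row (R : pzRingType) (I J : finType) (g : I * J -> R) i :
  \sum_t (t.1 == i)%:R * g t = \sum_j g (i, j).
Proof.
rewrite (eq_bigr (fun t => (t.1 == i)%:R * g (t.1, t.2))); last by case.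
rewrite -(pair_bigA _ (fun i' j => (i' == i)%:R * g (i', j))) (bigD1 i) //=.
rewrite [X in _ + X]big1 ?addr0 => [|i' /negbTE->].
  by under eq_bigr do rewrite eqxx mul1r.
by rewrite big1 // => j _; rewrite mul0r.
Qed.

Lemma sum_pair_col (R : pzRingType) (I J : finType) (g : I * J -> R) j :
  \sum_t (t.2 == j)%:R * g t = \sum_i g (i, j).
Proof.
rewrite (eq_bigr (fun t => (t.2 == j)%:R * g (t.1, t.2))); last by case.
rewrite -(pair_bigA _ (fun i j' => (j' == j)%:R * g (i, j'))).
apply: eq_bigr => i _; rewrite (bigD1 j) //= eqxx mul1r big1 ?addr0 //.
by move=> j' /negbTE->; rewrite mul0r.
Qed.

Section Transport.
Variables (R : realType) (E : finType) (M : matroid E).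
Implicit Types (x : {ffun E -> R^o}) (y : E -> E -> R) (B F G V : {set E}).

Local Notation r := (rk M [set: E]).
Local Notation rkR F := ((rk M F)%:R : R).

(** Rows outside [V] vanish, so column sums may run over all of [E]. *)
Definition transport V x y := [/\ forall v f, 0 <= y v f,
  forall v f, y v f != 0 -> v \in V /\ f |: (V :\ v) \in bases M,
  forall v, v \in V -> \sum_f y v f = 1 &
  forall f, \sum_v y v f = x f].

(** A convex combination of transports to bases is a transport to the same combination of their
    incidence vectors. *)
Lemma base_set_transport V x : V \in bases M -> base_set M x ->
  exists y, transport V x y.
Proof.
move=> VM [l [l0 l1 ->]].
have /choice[Y YP] (B : {B | B \in bases M}) :
    exists y, transport V (incidence R (val B)) y.
  case: B => B BM /=.
  have [y [y0 yM y1 yB]] := exchange_matrix R VM BM.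
  exists (fun v f => if v \in V then y v f else 0); split.
  - by move=> v f; case: ifP.
  - by move=> v f; case: ifP => [vV /(yM _ _ vV)//|]; rewrite eqxx.
  - by move=> v vV; rewrite vV y1.
  - by move=> f; rewrite ffunE -yB [RHS]big_mkcond.
exists (fun v f => \sum_B l B * Y B v f); split.
- by move=> v f; apply: sumr_ge0 => B _; rewrite mulr_ge0 //; case: (YP B).
- move=> v f; have [/existsP[B YB] _|] := boolP [exists B, Y B v f != 0].
    by have [_ yM _ _] := YP B; exact: yM.
  rewrite negb_exists => /forallP Y0; rewrite big1 ?eqxx // => B _.
  by have := Y0 B; rewrite negbK => /eqP->; rewrite mulr0.
- move=> v vV; rewrite exchange_big -l1; apply: eq_bigr => B _ /=.
  by have [_ _ y1 _] := YP B; rewrite -mulr_sumr y1 // mulr1.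
- move=> f; rewrite exchange_big sum_ffunE; apply: eq_bigr => B _ /=.
  by have [_ _ _ yB] := YP B; rewrite -mulr_sumr yB !ffunE.
Qed.

Lemma weight_transport V x y F : transport V x y ->
  weight x F = \sum_v \sum_(f in F) y v f.
Proof.
by move=> [_ _ _ yx]; rewrite exchange_big; apply: eq_bigr => f _; rewrite yx.
Qed.

Lemma transport_ge0 V x y e : transport V x y -> 0 <= x e.
Proof. by move=> [y0 _ _ <-]; exact: sumr_ge0. Qed.

Lemma weight_transportT V x y : V \in bases M -> transport V x y ->
  weight x [set: E] = rkR [set: E].
Proof.
move=> VM Ty; rewrite (weight_transport _ Ty) -(card_basis VM) -sum1_card.
case: Ty => y0 yM y1 _; rewrite natr_sum [RHS]big_mkcond; apply: eq_bigr => v _.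
rewrite (eq_bigl xpredT) => [|f]; last by rewrite inE.
case: ifPn => vV; first exact: y1.
by rewrite big1 // => f _; apply/eqP; apply: contraNT vV => /yM[].
Qed.

(* When [V] is optimal for [F], no exchange moves mass from [V :\: F] into [F]. *)
Lemma weight_transport_le V x y F : V \in bases M -> transport V x y ->
  full_intersection M V F -> weight x F <= rkR F.
Proof.
move=> VM Ty VF; rewrite (weight_transport _ Ty) -VF -sum1_card natr_sum.
case: Ty => y0 yM y1 _; rewrite [leRHS]big_mkcond; apply: ler_sum => v _.
rewrite inE; case: ifPn => [/andP[vV vF]|vVF].
  by rewrite -(y1 v vV) [leRHS](bigID (mem F)) /= lerDl sumr_ge0.
rewrite big1 // => f fF; apply/eqP; apply: contraNT vVF => /yM[vV VvM].
rewrite vV /=; have [->//|fv] := eqVneq v f.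
(* If [f] were another element of [V], the exchanged set would be too small for a basis. So this is
   a true exchange, and with [v] outside [F] it would give a basis meeting [F] in more than [rk M F]
   elements. *)
have fV : f \notin V.
  apply: contraTN VvM => fV; apply/negP => /card_basis.
  rewrite -(card_basis VM) cardsU1 !inE eq_sym fv fV /= add0n (cardsD1 v V) vV.
  lia.
have := leq_rk F VvM; have := card_exchangeI F vV fV; rewrite VF fF.
by case: (v \in F) => //; lia.
Qed.

(** Only these triples get a variable, so the support condition of a transport costs no
    constraint. *)
Definition exchanges (VV : {set {set E}}) : {set {set E} * E * E} :=
  [set t | [&& t.1.1 \in VV, t.1.2 \in t.1.1 &
               t.2 |: (t.1.1 :\ t.1.2) \in bases M]].

Lemma card_exchanges (VV : {set {set E}}) : VV \subset bases M ->
  (#|exchanges VV| <= #|VV| * #|E| * r)%N.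
Proof.
move=> /subsetP VVM; pose D := [set p : {set E} * E | (p.1 \in VV) && (p.2 \in p.1)].
have cD : #|D| = (#|VV| * r)%N.
  rewrite -sum1dep_card -(pair_big_dep _ (fun V v => v \in V) (fun _ _ => 1%N)) /=.
  rewrite -sum_nat_const; apply: eq_bigr => V /VVM VM.
  by rewrite sum1_card (card_basis VM).
rewrite mulnAC -cD -cardsT -cardsX; apply/subset_leq_card/subsetP => t.
by rewrite !inE andbT => /and3P[-> ->].
Qed.

(** All bases of [VV] share [x] but have separate transport variables. The [inl] equations fix row
    sums, the [inr] equations column sums; those indexed by sets outside [VV] read 0 = 0. *)
Lemma transport_extended_formulation (VV : {set {set E}}) :
  has_extended_formulation
    (fun x : {ffun E -> R^o} => forall V, V \in VV -> exists y, transport V x y)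
    #|exchanges VV|.
Proof.
have /choice[p pE] (e : E) : exists p : 'Hom({ffun E -> R^o} : vectType R, R^o),
    forall x, p x = x e.
  by apply: (@hom_of_linear _ _ _ (fun x => x e)) => t u v; rewrite !ffunE.
pose a (j : {set E} * E + {set E} * E) := match j with
  | inl _ => 0 | inr q => if q.1 \in VV then - p q.2 else 0 end.
pose c (j : {set E} * E + {set E} * E) (t : {set E} * E * E) : R := match j with
  | inl q => (t.1 == q)%:R | inr q => ((t.1.1, t.2) == q)%:R end.
pose d (j : {set E} * E + {set E} * E) : R := match j with
  | inl q => ((q.1 \in VV) && (q.2 \in q.1))%:R | inr _ => 0 end.
apply: (@system_extended_formulation _ _ _ _ _ (exchanges VV) a c d) => x.
(* Extension by zero lets the sums run over all triples. *)
pose ext (y : {set E} * E * E -> R) t := if t \in exchanges VV then y t else 0.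
have ext_sum (g y : {set E} * E * E -> R) :
    \sum_(t in exchanges VV) g t * y t = \sum_t g t * ext y t.
  by rewrite big_mkcond; apply: eq_bigr => t _; rewrite /ext; case: ifP; rewrite ?mulr0.
have rowE (y : {set E} * E * E -> R) V v :
    \sum_(t in exchanges VV) c (inl (V, v)) t * y t =
    \sum_f ext y (V, v, f) by rewrite ext_sum sum_pair_row.
have colE (y : {set E} * E * E -> R) V f :
    \sum_(t in exchanges VV) c (inr (V, f)) t * y t =
    \sum_v ext y (V, v, f).
  rewrite ext_sum -(sum_pair_row (fun q : {set E} * E => ext y (q, f)) V).
  apply: etrans (sum_pair_col (fun t : {set E} * E * E => (t.1.1 == V)%:R * ext y t) f).
  by apply: eq_bigr => t _; rewrite /c xpair_eqE mulrA -natrM mulnb andbC.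
split=> [xT|[y y0 ye] V VV_V].
  have /choice[Y YP] (V : {set E}) :
      exists y : E -> E -> R, V \in VV -> transport V x y.
    have [/xT[y yP]|_] := boolP (V \in VV); first by exists y.
    by exists (fun _ _ => 0).
  pose y (t : {set E} * E * E) := Y t.1.1 t.1.2 t.2.
  have extE V v f : ext y (V, v, f) = if V \in VV then Y V v f else 0.
    rewrite /ext inE /=; have [VV_V|] //= := boolP (V \in VV).
    case: ifPn => //= h; have [_ yM _ _] := YP V VV_V.
    by apply/esym/eqP; apply: contraNT h => /yM[-> ->].
  exists y => [t|[[V v]|[V f]]]; first by rewrite inE => /and3P[/YP[+ _ _ _] _ _]; apply.
    rewrite rowE lfunE add0r /=; under eq_bigr do rewrite extE.
    have [VV_V|_] /= := boolP (V \in VV); last by rewrite big1.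
    have [_ yM y1 _] := YP V VV_V; have [/y1//|vV] := boolP (v \in V).
    by rewrite big1 // => f _; apply/eqP; apply: contraNT vV => /yM[].
  rewrite colE /=; under eq_bigr do rewrite extE.
  have [VV_V|_] := boolP (V \in VV); last by rewrite lfunE add0r big1.
  have [_ _ _ ->] := YP V VV_V.
  by rewrite opp_lfunE pE addNr.
exists (fun v f => ext y (V, v, f)); split.
- by move=> v f; rewrite /ext; case: ifP => // /y0.
- by move=> v f; rewrite /ext inE /= VV_V /=; case: ifP => [/andP[]//|]; rewrite eqxx.
- by move=> v vV; have := ye (inl (V, v)); rewrite rowE /= VV_V vV lfunE add0r.
- move=> f; have := ye (inr (V, f)); rewrite colE /= VV_V opp_lfunE pE.
  by move=> /(canRL (addKr _)) ->; rewrite opprK addr0.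
Qed.

Lemma base_set_transportE (VV : {set {set E}}) : loopless M -> VV != set0 ->
  hitting_family R M VV -> forall x,
  base_set M x <-> forall V, V \in VV -> exists y, transport V x y.
Proof.
move=> ll VV0 [/subsetP VVM hit] x.
split=> [xP V /VVM VM|xT]; first exact: base_set_transport.
have [V0 VV_V0] := set0Pn _ VV0.
have V0M := VVM _ VV_V0; have [y0 Ty0] := xT _ VV_V0.
apply: base_set_flacets => // [e|G tG|F /hit[V VV_V VF]].
- exact: transport_ge0 Ty0.
- have VG (B : {set E}) : B \in bases M -> #|B :&: G| = rk M G.
    by move=> BM; apply/eqP; exact: (forall_inP tG).
  (* All bases have the same number of elements in [G], hence also outside, so [V0] is optimal for
     the complement too. The two resulting upper bounds add up to the total weight, which forces
     equality. *)
  have VCG : full_intersection M V0 (~: G).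
    rewrite /full_intersection; have [B BM <-] := full_intersection_exists M (~: G).
    have := cardsID G V0; have := cardsID G B.
    rewrite !setDE !VG // (card_bases_eq BM V0M); lia.
  have le1 := weight_transport_le V0M Ty0 (VG _ V0M).
  have le2 := weight_transport_le V0M Ty0 VCG.
  have := weight_transportT V0M Ty0; rewrite (weightID _ _ G) setTI setTD => wT.
  apply/eqP; rewrite eq_le le1 -(lerD2r (weight x (~: G))) wT -(card_basis V0M).
  by rewrite -(cardsID G) natrD setDE VCG VG ?lerD2l.
- by have [y Ty] := xT _ VV_V; exact: weight_transport_le (VVM _ VV_V) Ty VF.
Qed.

End Transport.

Theorem theorem4 (R : realType) :
  exists C : nat,
    forall (E : finType) (M : matroid E), loopless M ->
      (xc (base_polytope R M) <=
         C * (maxn 1 (hitting_number R M) * #|E| * rk M [set: E]%SET))%N.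
Proof.
exists 1%N => E M ll; rewrite mul1n /xc; case: ex_minnP => k _ mink.
rewrite /hitting_number; case: ex_minnP => h /asboolP[V0 [V0M V0hit] <-] _.
have [VV [VVhit VV0 VVh]] : exists VV, [/\ hitting_family R M VV, VV != set0 &
    (#|VV| <= maxn 1 #|V0|)%N].
  (* An empty hitting family means that there are no flacets, so any single basis forms a hitting
     family; this case is why the bound has [maxn 1]. *)
  have [V00|] := eqVneq V0 set0; last by exists V0; rewrite leq_maxr.
  have /set0Pn[B BM] := bases_neq0 M; exists [set B]; split.
  - by split=> [|F /V0hit[B']]; rewrite ?sub1set // V00 inE.
  - by apply/set0Pn; exists B; rewrite inE.
  - by rewrite cards1 leq_maxl.
apply: (@leq_trans #|exchanges M VV|).
  apply: mink; apply/asboolP.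
  have := transport_extended_formulation R M VV; congr has_extended_formulation.
by apply/funext => x; apply/propext; apply: iff_sym; exact: base_set_transportE.
have [VVM _] := VVhit.
by apply: leq_trans (card_exchanges VVM) _; rewrite !leq_mul2r VVh !orbT.
Qed.
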